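(* Let $T>0$, let $H(t,p)\in C^1([0,T]\times\mathbb{R}^n)$, and let $\sigma$ be convex and Lipschitz on $\mathbb{R}^n$. Let $t_+\in(0,T)$ be such that $H$ satisfies condition (A2) on $[0,t_+]\times\mathbb{R}^n$ and on $[t_+,T]\times\mathbb{R}^n$. Then the function $$u(t,x)=\begin{cases}\Big(\sigma^*+\int_0^tH(\tau,\cdot)\,d\tau\Big)^*(x), & (t,x)\in[0,t_+]\times\mathbb{R}^n,\\[1ex] \Big(\omega^*+\int_{t_+}^tH(\tau,\cdot)\,d\tau\Big)^*(x), & (t,x)\in[t_+,T]\times\mathbb{R}^n,\end{cases}$$ where $\omega(x)=u(t_+,x)=\big(\sigma^*+\int_0^{t_+}H(\tau,\cdot)d\tau\big)^*(x)$, is semiconvex (with linear modulus) on $\Omega=(0,T)\times\mathbb{R}^n$.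
   Context: For $f:\mathbb{R}^n\to\mathbb{R}\cup\{+\infty\}$, $f^*(y)=\sup_{q\in\mathbb{R}^n}\{\langle y,q\rangle-f(q)\}$ is the Fenchel conjugate. Condition (A2) on $[a,b]\times\mathbb{R}^n$: either (a) $H(t,\cdot)$ is convex for all $t\in[a,b]$, or concave for all $t\in[a,b]$; or (b) $H(t,p)=g(t)h(p)+k(t)$ for some functions $g,h,k$ with $g$ not changing sign on $[a,b]$. A function $v:\Omega\to\mathbb{R}$ is semiconvex with linear modulus if there is a constant $C>0$ such that $v(\lambda y_1+(1-\lambda)y_2)-\lambda v(y_1)-(1-\lambda)v(y_2)\le\lambda(1-\lambda)\frac C2|y_1-y_2|^2$ for all $y_1=(t_1,x_1),y_2=(t_2,x_2)\in\Omega$ and all $\lambda\in[0,1]$. *)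

(* Defs.v *)
From HB Require Import structures.
From mathcomp Require Import all_boot all_order all_algebra.
From mathcomp Require Import all_classical all_reals all_analysis.
Set Implicit Arguments. Unset Strict Implicit. Unset Printing Implicit Defensive.
Import Order.TTheory GRing.Theory Num.Theory.
Import numFieldNormedType.Exports.
Local Open Scope classical_set_scope.
Local Open Scope ring_scope.

Section Defs.
Variables (R : realType) (n : nat).
Implicit Types (x y p q : 'rV[R]_n).

Definition dotp x y : R := \sum_(i < n) x ord0 i * y ord0 i.
Definition sqnorm x : R := dotp x x.
Definition enorm x : R := Num.sqrt (sqnorm x).

Definition fconj (f : 'rV[R]_n -> \bar R) (y : 'rV[R]_n) : \bar R :=
  ereal_sup [set ((dotp y q)%:E - f q)%E | q in [set: 'rV[R]_n]].

Definition convex_fun (f : 'rV[R]_n -> R) : Prop :=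
  forall x y (l : R), 0 <= l <= 1 ->
    f (l *: x + (1 - l) *: y) <= l * f x + (1 - l) * f y.

Definition concave_fun (f : 'rV[R]_n -> R) : Prop :=
  forall x y (l : R), 0 <= l <= 1 ->
    l * f x + (1 - l) * f y <= f (l *: x + (1 - l) *: y).

Definition lipschitz_fun (f : 'rV[R]_n -> R) : Prop :=
  exists L : R, forall x y, `|f x - f y| <= L * enorm (x - y).

(* H is C^1 on [0,T] x R^n: H is the restriction of a function
   G : R x R^n -> R that has continuous directional derivatives
   in every direction (hence is C^1) on all of R x R^n. *)
Definition C1_on_strip (T : R) (H : R -> 'rV[R]_n -> R) : Prop :=
  exists G : R * 'rV[R]_n -> R,
    (forall z v, derivable G z v) /\
    (forall v, continuous ('D_v G)) /\
    (forall t p, 0 <= t <= T -> G (t, p) = H t p).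

Definition condA2 (a b : R) (H : R -> 'rV[R]_n -> R) : Prop :=
  (forall t, a <= t <= b -> convex_fun (H t)) \/
  (forall t, a <= t <= b -> concave_fun (H t)) \/
  (exists (g : R -> R) (h : 'rV[R]_n -> R) (k : R -> R),
     (forall t p, a <= t <= b -> H t p = g t * h p + k t) /\
     ((forall t, a <= t <= b -> 0 <= g t) \/ (forall t, a <= t <= b -> g t <= 0))).

Definition intH (H : R -> 'rV[R]_n -> R) (a b : R) (q : 'rV[R]_n) : R :=
  Rintegral lebesgue_measure `[a, b] (fun tau => H tau q).

Definition u_first (sigma : 'rV[R]_n -> R) (H : R -> 'rV[R]_n -> R) (t : R)
    (x : 'rV[R]_n) : \bar R :=
  fconj (fun q => (fconj (fun p => (sigma p)%:E) q + (intH H 0 t q)%:E)%E) x.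

Definition u_second (sigma : 'rV[R]_n -> R) (H : R -> 'rV[R]_n -> R) (tp t : R)
    (x : 'rV[R]_n) : \bar R :=
  fconj (fun q => (fconj (u_first sigma H tp) q + (intH H tp t q)%:E)%E) x.

Definition u_fun (sigma : 'rV[R]_n -> R) (H : R -> 'rV[R]_n -> R) (tp t : R)
    (x : 'rV[R]_n) : \bar R :=
  if t <= tp then u_first sigma H t x else u_second sigma H tp t x.

Definition semiconvex_lin (T : R) (v : R -> 'rV[R]_n -> R) : Prop :=
  exists C : R, 0 < C /\
    forall (t1 t2 : R) (x1 x2 : 'rV[R]_n) (l : R),
      0 < t1 < T -> 0 < t2 < T -> 0 <= l <= 1 ->
      v (l * t1 + (1 - l) * t2) (l *: x1 + (1 - l) *: x2)
        - l * v t1 x1 - (1 - l) * v t2 x2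
      <= l * (1 - l) * (C / 2) * ((t1 - t2) ^+ 2 + sqnorm (x1 - x2)).

End Defs.

(* Main.v *)
Require Import Defs.
From mathcomp Require Import all_boot all_order all_algebra.
From mathcomp Require Import all_classical all_reals all_analysis.
From mathcomp Require Import ring lra.
Import Order.TTheory GRing.Theory Num.Theory.
Import numFieldNormedType.Exports.
Local Open Scope classical_set_scope.
Local Open Scope ring_scope.

(** Since sigma is Lipschitz, the domain of sigma^* lies in a bounded box, on
    which [H] is [K]-Lipschitz in time; hence each function
    [(t, x) |-> <x, q> - sigma^*(q) - \int_0^t H(tau, q) dtau], with [q] in that
    domain, becomes convex after adding [K t^2], and so does their supremum.  The
    same holds for the second piece on [[t_+, T]], because omega has the same linear
    growth as sigma and omega^* thus lives in the same box.  To patch the pieces,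
    note that omega^* <= sigma^* + \int_0^{t_+} H, so the second piece dominates
    the extension of the first one to [[0, T]], while both agree at [t_+]: the
    kink at [t_+] can only be convex. *)

(** * Dot product and norms on row vectors *)

Section DotProduct.
Context {R : realType} {n : nat}.
Implicit Types (x y q : 'rV[R]_n).

(** The norm dual to the sup norm behind the boxes below, so that no dimensional constant enters the
    estimates. *)
Definition l1norm x : R := \sum_(i < n) `|x ord0 i|.

Lemma dotpDl x y q : dotp (x + y) q = dotp x q + dotp y q.
Proof. by rewrite /dotp -big_split; apply: eq_bigr => i _; rewrite mxE mulrDl. Qed.

Lemma dotpZl a x q : dotp (a *: x) q = a * dotp x q.
Proof. by rewrite /dotp mulr_sumr; apply: eq_bigr => i _; rewrite mxE mulrA. Qed.

Lemma dotpC x y : dotp x y = dotp y x.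
Proof. by apply: eq_bigr => i _; rewrite mulrC. Qed.

Lemma dotp_delta_mx i q : dotp (delta_mx ord0 i) q = q ord0 i.
Proof.
rewrite /dotp (bigD1 i)//= big1 ?addr0 ?mxE ?eqxx ?mul1r// => j ji.
by rewrite mxE (negbTE ji) andbF mul0r.
Qed.

Lemma l1norm_delta_mx a i : l1norm (a *: delta_mx ord0 i) = `|a|.
Proof.
rewrite /l1norm (bigD1 i)//= big1 ?addr0 ?mxE ?eqxx ?mulr1// => j ji.
by rewrite !mxE (negbTE ji) andbF mulr0 normr0.
Qed.

Lemma l1norm0 : l1norm 0 = 0.
Proof. by rewrite /l1norm big1// => i _; rewrite mxE normr0. Qed.

Lemma l1norm_ge0 x : 0 <= l1norm x.
Proof. exact: sumr_ge0. Qed.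

Lemma dotp_le_l1norm M x q :
  (forall i, `|q ord0 i| <= M) -> dotp x q <= M * l1norm x.
Proof.
move=> qM; rewrite /dotp /l1norm mulr_sumr; apply: ler_sum => i _.
by rewrite (le_trans (ler_norm _))// normrM mulrC ler_wpM2r.
Qed.

Lemma sqnorm_ge0 x : 0 <= sqnorm x.
Proof. by apply: sumr_ge0 => i _; rewrite -expr2 sqr_ge0. Qed.

Lemma enorm_le_l1norm x : enorm x <= l1norm x.
Proof.
rewrite /enorm -(ger0_norm (l1norm_ge0 x)) -sqrtr_sqr ler_wsqrtr// expr2.
rewrite {1}/l1norm mulr_suml; apply: ler_sum => i _.
rewrite (le_trans (ler_norm _))// normrM ler_wpM2l// /l1norm (bigD1 i)//= lerDl; exact: sumr_ge0.
Qed.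

End DotProduct.

(** * Affine minorants of finite convex functions *)

Section AffineMinorant.
Context {R : realType} {n : nat}.
Implicit Types (f : 'rV[R]_n -> R) (V : set 'rV[R]_n).

(** Hahn-Banach extension by one direction: backward slopes from points of [V] never exceed forward
    ones, so the supremum of the backward slopes serves as [c]. *)
Lemma convex_fun_extend_minorant f V (e : 'rV[R]_n) :
  convex_fun f -> V 0 ->
  (forall x y l, 0 <= l <= 1 -> V x -> V y -> V (l *: x + (1 - l) *: y)) ->
  (forall y, V y -> 0 <= f y) ->
  exists c, forall y s, V y -> c * s <= f (y + s *: e).
Proof.
move=> cf V0 Vc f0.
pose S := [set z | exists y r, [/\ V y, 0 < r & z = - f (y - r *: e) / r]].
have SS y r y' r' : V y -> V y' -> 0 < r -> 0 < r' ->
    - f (y' - r' *: e) / r' <= f (y + r *: e) / r.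
  move=> Vy Vy' r0 r'0.
  rewrite ler_pdivrMr// mulrAC ler_pdivlMr// mulNr.
  (* With this weight the [e] components cancel, so the combination lands in [V], where [f] is
     nonnegative. *)
  set l := r' / (r + r').
  have rr : 0 < r + r' by rewrite addr_gt0.
  have l1 : 1 - l = r / (r + r') by rewrite /l; field; rewrite gt_eqF.
  have l01 : 0 <= l <= 1.
    by rewrite -subr_ge0 l1 !divr_ge0// ltW.
  have := cf (y + r *: e) (y' - r' *: e) l l01.
  have -> : l *: (y + r *: e) + (1 - l) *: (y' - r' *: e) = l *: y + (1 - l) *: y'.
    rewrite !scalerDr scalerN !scalerA l1 /l addrACA.
    by rewrite (_ : r / (r + r') * r' = r' / (r + r') * r) ?subrr ?addr0//; ring.
  have /f0 h := Vc y y' l l01 Vy Vy'.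
  move=> /(le_trans h); rewrite l1 /l => {}h.
  have : 0 <= r' * f (y + r *: e) + r * f (y' - r' *: e).
    rewrite -(pmulr_rge0 _ (_ : 0 < (r + r')^-1)) ?invr_gt0//.
    by apply: le_trans h _; rewrite le_eqVlt; apply/orP; left; apply/eqP; ring.
  lra.
have Sne : S !=set0.
  by exists (- f (0 - 1 *: e) / 1); exists 0, 1; split.
have Sub : has_ubound S.
  exists (f (0 + 1 *: e) / 1) => _ [y [r [Vy r0 ->]]].
  exact: SS.
exists (sup S) => y s Vy.
have [s0|s0|->] := ltgtP s 0; last first.
- by rewrite mulr0 scale0r addr0 f0.
- rewrite -ler_pdivlMr//; apply: ge_sup => // _ [y' [r' [Vy' r'0 ->]]].
  exact: SS.
- have : - f (y - (- s) *: e) / (- s) <= sup S.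
    by apply: ub_le_sup => //; exists y, (- s); rewrite oppr_gt0.
  rewrite scaleNr opprK ler_pdivrMr ?oppr_gt0//; lra.
Qed.

(** A subgradient at 0 is built one coordinate at a time, by induction on the span [V k] of the
    first [k] basis vectors. *)
Lemma convex_fun_affine_minorant f : convex_fun f ->
  exists a, forall x, f 0 + dotp a x <= f x.
Proof.
move=> cf.
pose V k : set 'rV[R]_n := [set x | forall i : 'I_n, (k <= i)%N -> x ord0 i = 0].
suff /(_ n (leqnn n)) [a fa] : forall k, (k <= n)%N ->
    exists a, forall x, V k x -> f 0 + dotp a x <= f x.
  by exists a => x; apply: fa => i; rewrite leqNgt ltn_ord.
elim=> [_|k IH kn].
  exists 0 => x Vx; have -> : x = 0.
    by apply/rowP => i; rewrite Vx// mxE.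
  by rewrite /dotp big1 ?addr0// => i _; rewrite !mxE mulr0.
have [a fa] := IH (ltnW kn).
pose e : 'rV[R]_n := delta_mx ord0 (Ordinal kn).
have cg : convex_fun (fun x => f x - f 0 - dotp a x).
  move=> x y l l01; have := cf x y l l01.
  by rewrite !(dotpC a) dotpDl !dotpZl; lra.
have [||y|c cP] := convex_fun_extend_minorant _ (V k) e cg.
- by move=> i _; rewrite mxE.
- by move=> x y l _ Vx Vy i ki; rewrite !mxE Vx// Vy// !mulr0 addr0.
- by move=> /fa; lra.
exists (a + c *: e) => x Vx.
pose y := x - x ord0 (Ordinal kn) *: e.
have Vy : V k y.
  move=> i; rewrite leq_eqVlt => /predU1P[ki|ki].
    have -> : i = Ordinal kn by apply/val_inj.
    by rewrite !mxE !eqxx mulr1 subrr.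
  have ik : (i == Ordinal kn) = false by rewrite -val_eqE/= gtn_eqF.
  by rewrite !mxE (Vx i)// ik andbF mulr0 subr0.
have := cP y (x ord0 (Ordinal kn)) Vy.
by rewrite subrK dotpDl dotpZl dotp_delta_mx; lra.
Qed.

End AffineMinorant.

(** * Fenchel conjugates with bounded effective domain *)

Section Conjugate.
Context {R : realType} {n : nat}.
Implicit Types (x y p q : 'rV[R]_n) (A f g : 'rV[R]_n -> \bar R) (phi : 'rV[R]_n -> R).

Definition in_box (M : R) q := forall i, `|q ord0 i| <= M.

Definition proper_in_box (M : R) A :=
  [/\ exists c, forall q, (c%:E <= A q)%E,
      exists q, (A q < +oo)%E &
      forall q, (A q < +oo)%E -> in_box M q].

Lemma fconj_ge f y q : ((dotp y q)%:E - f q <= fconj f y)%E.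
Proof. by apply: ereal_sup_ubound; exists q. Qed.

Lemma fconj_le f y (z : \bar R) :
  (forall q, (dotp y q)%:E - f q <= z)%E -> (fconj f y <= z)%E.
Proof. by move=> fz; apply: ge_ereal_sup => _ [q _ <-]. Qed.

Lemma le_fconj f g y : (forall q, g q <= f q)%E -> (fconj f y <= fconj g y)%E.
Proof.
move=> gf; apply: fconj_le => q; apply: le_trans (fconj_ge g y q).
exact: leeB.
Qed.

(** The Fenchel-Young inequality, rearranged. It is the source of both comparisons between the two
    pieces. *)
Lemma fconjK_le f y : (fconj (fconj f) y <= f y)%E.
Proof.
apply: fconj_le => q.
have := fconj_ge f q y; rewrite dotpC.
case: (f y) => [r| |]; case: (fconj f q) => [s| |]; rewrite ?leey//=.
  by rewrite -!EFinB !lee_fin; lra.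
by move=> _; exact: leNye.
Qed.

(** If [|q_i| > M], then [<q, p> - M |p|_1] is unbounded along the [i]-th axis, which forces the
    conjugate to be infinite at [q]. The lower bound comes from [p = 0]. *)
Lemma proper_in_box_fconj M f : 0 <= M ->
  (exists c, forall p, (f p <= (c + M * l1norm p)%:E)%E) ->
  (exists q, (fconj f q < +oo)%E) -> proper_in_box M (fconj f).
Proof.
move=> M0 [c fc] fq.
have ge q p : ((dotp q p - (c + M * l1norm p))%:E <= fconj f q)%E.
  by apply: le_trans (fconj_ge f q p); rewrite EFinB leeB.
split => //.
  exists (- c) => q; apply: le_trans (ge q 0).
  by rewrite dotpC -(scale0r q) dotpZl scale0r l1norm0 !mul0r mulr0 addr0 sub0r.
move=> q fqoo i; rewrite leNgt; apply/negP => qM.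
have [r fqr] : exists r, (fconj f q <= r%:E)%E.
  by case: (fconj f q) fqoo => // [r|] _; [exists r|exists 0; exact: leNye].
(* Chosen so that the lower bound at [p = s sgn(q_i) e_i] is at least [|r + c| + 1 - c], which
   exceeds [r]. *)
pose s := (`|r + c| + 1) / (`|q ord0 i| - M).
have s0 : 0 <= s by apply: divr_ge0; [exact: addr_ge0|rewrite subr_ge0 ltW].
have := le_trans (ge q ((s * Num.sg (q ord0 i)) *: delta_mx ord0 i)) fqr.
rewrite lee_fin dotpC dotpZl dotp_delta_mx l1norm_delta_mx normrM (ger0_norm s0).
rewrite -mulrA -normrEsg.
have s1 : s * `|Num.sg (q ord0 i)| <= s.
  by rewrite normr_sg ler_piMr// lern1 leq_b1.
have sE : s * (`|q ord0 i| - M) = `|r + c| + 1.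
  by rewrite divfK// gt_eqF// subr_gt0.
have rc := ler_norm (r + c).
by have := ler_wpM2l M0 s1; lra.
Qed.

(* The bound is uniform in [x]; it keeps the domain of the next conjugate in the same box. *)
Lemma fconj_linear_growth M A phi B : proper_in_box M A ->
  (forall q, in_box M q -> `|phi q| <= B) ->
  exists c, forall x,
    (fconj (fun q => A q + (phi q)%:E)%E x <= (c + M * l1norm x)%:E)%E.
Proof.
move=> [[c Ac] _ Abox] phiB; exists (B - c) => x; apply: fconj_le => q.
have := Ac q; have := Abox q.
case: (A q) => [r| |]//; last by rewrite leNye.
move=> /(_ (ltry _)) qM; rewrite -[(r%:E + _)%E]EFinD -EFinB !lee_fin => cr.
have := dotp_le_l1norm M x q qM; have := phiB q qM.
by rewrite ler_norml; lra.
Qed.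

Lemma fconj_fin_num M A phi B x : proper_in_box M A ->
  (forall q, in_box M q -> `|phi q| <= B) ->
  fconj (fun q => A q + (phi q)%:E)%E x \is a fin_num.
Proof.
move=> MA phiB; have [c xc] := fconj_linear_growth M A phi B MA phiB.
rewrite fin_numElt (le_lt_trans (xc x)) ?ltry// andbT.
have [[d Ad] [q Aq] _] := MA.
apply: lt_le_trans (fconj_ge _ x q).
by move: (Ad q) Aq; case: (A q) => // r _ _; rewrite -[(r%:E + _)%E]EFinD -EFinB ltNyr.
Qed.

(** The inequality holds for each [q] in the supremum, with an error [E] independent of [q]; where
    [A q] is infinite the term is [-oo]. *)
Lemma fconj_semiconvex (l E : R) A phi phi1 phi2 x1 x2 : 0 <= l <= 1 ->
  (forall q, A q != -oo%E) ->
  (forall q, (A q < +oo)%E -> l * phi1 q + (1 - l) * phi2 q <= phi q + E) ->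
  let u phi := fconj (fun q => A q + (phi q)%:E)%E in
  u phi1 x1 \is a fin_num -> u phi2 x2 \is a fin_num ->
  (u phi (l *: x1 + (1 - l) *: x2)%R
     <= (l * fine (u phi1 x1) + (1 - l) * fine (u phi2 x2) + E)%:E)%E.
Proof.
move=> l01 Ay phiE u u1 u2; apply: fconj_le => q.
have q1 := fconj_ge (fun q => A q + (phi1 q)%:E)%E x1 q.
have q2 := fconj_ge (fun q => A q + (phi2 q)%:E)%E x2 q.
have := Ay q; have := phiE q.
move: q1 q2; rewrite -[fconj _ x1](fineK u1) -[fconj _ x2](fineK u2).
case: (A q) => [r| |]//; last by rewrite !leNye.
rewrite -![(r%:E + _)%E]EFinD -!EFinB !lee_fin dotpDl !dotpZl => q1 q2 /(_ (ltry _)) h _.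
have [l0 l1] : 0 <= l /\ 0 <= 1 - l by lra.
have := ler_wpM2l l0 q1; have := ler_wpM2l l1 q2.
lra.
Qed.

End Conjugate.

(** * Gluing convex functions along a hyperplane [t = c] *)

Section Gluing.
Context {R : realType} {V : lmodType R}.

Definition jointly_convex (a b : R) (w : R -> V -> R) :=
  forall t1 t2 x1 x2 l, a <= t1 <= b -> a <= t2 <= b -> 0 <= l <= 1 ->
    w (l * t1 + (1 - l) * t2) (l *: x1 + (1 - l) *: x2)
      <= l * w t1 x1 + (1 - l) * w t2 x2.

(* No one-sided derivatives are needed: the segment crosses [t = c] at a point
   where [w1] and [w2] agree; convexity of [w2] bounds the value at the given
   point by the value at the crossing point, and convexity of [w1 <= w2]
   bounds the latter by a fraction, less than one, of the former. *)
Lemma jointly_convex_glue (a b c : R) (w1 w2 : R -> V -> R) : a <= c <= b ->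
  jointly_convex a b w1 -> jointly_convex c b w2 ->
  (forall t x, c <= t <= b -> w1 t x <= w2 t x) ->
  (forall x, w2 c x <= w1 c x) ->
  jointly_convex a b (fun t x => if t <= c then w1 t x else w2 t x).
Proof.
move=> acb cw1 cw2 w12 w21.
set w := fun t x => _.
have w1w t x : t <= b -> w1 t x <= w t x.
  by move=> tb; rewrite /w; case: ifPn => //; rewrite -ltNge => /ltW ct; rewrite w12 ?ct.
have w2w t x : c <= t -> w2 t x <= w t x.
  move=> ct; rewrite /w; case: ifPn => // tc.
  by have -> : t = c by apply/eqP; rewrite eq_le tc ct.
have main t1 t2 x1 x2 l : a <= t1 <= b -> a <= t2 <= b -> 0 <= l <= 1 ->
    t1 <= t2 -> w (l * t1 + (1 - l) * t2) (l *: x1 + (1 - l) *: x2)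
      <= l * w t1 x1 + (1 - l) * w t2 x2.
  move=> t1ab t2ab l01 t12.
  set t := l * t1 + _; set x := l *: x1 + _.
  have l0 : 0 <= l by lra.
  have l1 : 0 <= 1 - l by lra.
  have conv0 (v1 v2 v1' v2' : R) : v1 <= v1' -> v2 <= v2' ->
      l * v1 + (1 - l) * v2 <= l * v1' + (1 - l) * v2'.
    by move=> *; apply: lerD; apply: ler_wpM2l.
  rewrite {1}/w; case: (leP t c) => tc.
    apply: le_trans (cw1 _ _ _ _ _ t1ab t2ab l01) _.
    by apply: conv0; apply: w1w; lra.
  have [ct1|t1c] := leP c t1.
    apply: le_trans (cw2 _ _ _ _ _ _ _ l01) _; [lra|lra|].
    by apply: conv0; apply: w2w; lra.
  have ct2 : c < t2.
    by rewrite ltNge; apply/negP => ?; move: tc; rewrite /t; nra.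
  have tt2 : t <= t2 by rewrite /t; nra.
  have t12' : 0 < t2 - t1 by lra.
  have tE : t - t1 = (1 - l) * (t2 - t1) by rewrite /t; ring.
  (* [c = m * t1 + (1 - m) * t] and [t = k * c + (1 - k) * t2] *)
  pose m := (t - c) / (t - t1).
  pose k := (t2 - t) / (t2 - c).
  have tt1 : t - t1 != 0 by rewrite gt_eqF; lra.
  have t2c : t2 - c != 0 by rewrite gt_eqF; lra.
  have m01 : 0 <= m <= 1.
    by rewrite divr_ge0 ?ler_pdivrMr; lra.
  have k01 : 0 <= k <= 1.
    by rewrite divr_ge0 ?ler_pdivrMr; lra.
  have cE : c = m * t1 + (1 - m) * t.
    by rewrite /m; move: (t) tt1 => t' tt1; field.
  have tE2 : t = k * c + (1 - k) * t2.
    by rewrite /k; move: (t) => t'; field.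
  have m0 : 0 < m by rewrite divr_gt0; lra.
  clearbody m k.
  have D0 : 0 < 1 - k * (1 - m) by nra.
  (* Substituting [cE] into [tE2] and comparing with [t = l * t1 + (1 - l) * t2] gives this, since
     [t1] and [t2] differ. *)
  have kml : k * m = l * (1 - k * (1 - m)).
    apply/(mulIf (lt0r_neq0 t12'))/eqP; rewrite -subr_eq0; apply/eqP.
    have := tE2; rewrite {1}cE => /eqP; rewrite -subr_eq0 => /eqP <-.
    by rewrite /t; ring.
  pose z := m *: x1 + (1 - m) *: x.
  have xE : x = k *: z + (1 - k) *: x2.
    rewrite /z scalerDr !scalerA {2}/x scalerDr !scalerA addrA -scalerDl -addrA -scalerDl.
    by congr (_ *: _ + _ *: _); lra.
  have h1 : w1 c z <= m * w1 t1 x1 + (1 - m) * w1 t x.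
    by rewrite {1}cE; apply: cw1; lra.
  have h2 : w2 t x <= k * w2 c z + (1 - k) * w2 t2 x2.
    by rewrite {1}tE2 {1}xE; apply: cw2; lra.
  have h3 : w1 t1 x1 <= w t1 x1 by apply: w1w; lra.
  have h4 : w2 t2 x2 <= w t2 x2 by apply: w2w; lra.
  have h5 : w1 t x <= w2 t x by apply: w12; lra.
  have h6 := w21 z.
  (* The bound on [w2 t x] contains [w2 t x] again with coefficient [k * (1 - m)]; moving it to the
     left leaves the positive factor [1 - k * (1 - m)]. *)
  rewrite -(ler_pM2l D0).
  have k0 : 0 <= k by lra.
  have /(ler_wpM2l k0) : w2 c z <= m * w t1 x1 + (1 - m) * w2 t x.
    apply: (le_trans h6); apply: (le_trans h1).
    by apply: lerD; apply: ler_wpM2l => //; lra.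
  have k1 : 0 <= 1 - k by lra.
  have := ler_wpM2l k1 h4.
  have -> : (1 - k * (1 - m)) * (l * w t1 x1 + (1 - l) * w t2 x2) =
     k * m * w t1 x1 + (1 - k) * w t2 x2.
    rewrite mulrDr !mulrA [_ * l]mulrC -kml; congr (_ + _ * _).
    lra.
  move: h2; lra.
move=> t1 t2 x1 x2 l t1ab t2ab l01; have [t12|t21] := leP t1 t2.
  exact: main.
have := main t2 t1 x2 x1 (1 - l) t2ab t1ab.
by rewrite subKr (addrC (_ * t2)) (addrC (_ *: x2)) (addrC (_ * w t2 x2)); apply; lra.
Qed.

End Gluing.

(** * Mean value bounds along lines *)

Section DirectionalDerivative.
Context {R : realType} {V : normedModType R}.
Implicit Types (G : V -> R) (z v : V).

Lemma is_derive_line G z v (t : R) : derivable G (z + t *: v) v ->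
  is_derive t 1 (fun s : R => G (z + s *: v)) ('D_v G (z + t *: v)).
Proof.
move=> dG.
have E : (fun h : R => h^-1 *: (((fun s : R => G (z + s *: v)) \o shift t) (h *: 1)
           - G (z + t *: v))) =
    (fun h : R => h^-1 *: ((G \o shift (z + t *: v)) (h *: v) - G (z + t *: v))).
  apply/funext => h /=; congr (_ *: (G _ - _)).
  by rewrite /shift/= [h *: 1]mulr1 scalerDl addrCA.
by apply: DeriveDef; rewrite /derivable /derive E.
Qed.

Lemma derive_line_lipschitz G z v (K a b : R) : a <= b ->
  (forall y, derivable G y v) ->
  (forall s, a <= s <= b -> `|'D_v G (z + s *: v)| <= K) ->
  `|G (z + b *: v) - G (z + a *: v)| <= K * (b - a).
Proof.
move=> ab dG DK.
have [||c cab ->] := @MVT_segment R (fun s : R => G (z + s *: v))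
    (fun s => 'D_v G (z + s *: v)) a b ab.
- by move=> s _; exact: is_derive_line.
- apply: derivable_within_continuous => s _.
  by case: (is_derive_line G z v s (dG _)).
- rewrite normrM (@ger0_norm _ (b - a)) ?subr_ge0//.
  by rewrite ler_wpM2r ?subr_ge0// DK.
Qed.

Lemma continuous_compact_norm_le (C : set V) (F : V -> R) :
  compact C -> continuous F -> exists2 K, 0 <= K & forall y, C y -> `|F y| <= K.
Proof.
move=> cC cF.
have /compact_bounded[K [Kreal KP]] :
    compact (F @` C : set R^o).
  by apply: continuous_compact => //; exact: continuous_subspaceT.
(* [compact_bounded] yields every bound strictly above [K], hence the shift by one. *)
exists (`|K| + 1); first by rewrite addr_ge0.
move=> y Cy; apply: KP; last by exists y.
by rewrite (le_lt_trans (ler_norm _))// ltrDl.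
Qed.

End DirectionalDerivative.

(** * Bounds for a C^1 Hamiltonian on a compact strip *)

Section C1Strip.
Context {R : realType} {n : nat}.
Implicit Types (G : R * 'rV[R]_n -> R) (H : R -> 'rV[R]_n -> R) (q : 'rV[R]_n).

Lemma compact_strip_box (T M : R) :
  compact [set z : R * 'rV[R]_n | 0 <= z.1 <= T /\ in_box M z.2].
Proof.
have -> : [set z : R * 'rV[R]_n | 0 <= z.1 <= T /\ in_box M z.2] =
    `[0, T] `*` [set q : 'rV[R]_n | forall i, `[(- M), M]%classic (q ord0 i)].
  apply/seteqP; split => -[t q] [tT qM]; split.
  - by rewrite /= in_itv.
  - by move=> i /=; have := qM i; rewrite in_itv/= ler_norml.
  - by move: tT; rewrite /= in_itv.
  - by move=> i; have := qM i; rewrite /= in_itv/= ler_norml.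
apply: compact_setX; first exact: segment_compact.
by apply: (@rV_compact R n (fun=> `[(- M), M]%classic)) => i; exact: segment_compact.
Qed.

(** The data give continuity of the directional derivatives rather than of [G], so [q] is reached
    from 0 along coordinate edges, each contributing at most [K i * M] by the mean value theorem. *)
Lemma box_bounded G (M : R) : 0 <= M ->
  (forall z v, derivable G z v) -> (forall v, continuous ('D_v G)) ->
  exists B, forall q, in_box M q -> `|G (0, q)| <= B.
Proof.
move=> M0 dG cG.
pose C := [set z : R * 'rV[R]_n | 0 <= z.1 <= 0 /\ in_box M z.2].
pose e i : R * 'rV[R]_n := (0, delta_mx ord0 i).
have /choice[K KP] (i : 'I_n) : exists K, 0 <= K /\
    forall y, C y -> `|'D_(e i) G y| <= K.
  have [K K0 KP] := continuous_compact_norm_le C _ (compact_strip_box 0 M) (cG (e i)).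
  by exists K.
pose p (q : 'rV[R]_n) (k : nat) : 'rV[R]_n := \row_i (if (i < k)%N then q ord0 i else 0).
suff H k q : (k <= n)%N -> in_box M q ->
    `|G (0, p q k)| <= `|G (0, 0)| + \sum_(i < n | (i < k)%N) K i * M.
  exists (`|G (0, 0)| + \sum_(i < n | (i < n)%N) K i * M) => q qM.
  have := H n q (leqnn n) qM.
  have -> // : p q n = q by apply/rowP => i; rewrite mxE ltn_ord.
elim: k => [_ qM|k IH kn qM].
  rewrite big_pred0// addr0; have -> // : p q 0%N = 0.
  by apply/rowP => i; rewrite !mxE.
have {IH}H := IH (ltnW kn) qM.
pose j := Ordinal kn.
have -> : \sum_(i < n | (i < k.+1)%N) K i * M
    = K j * M + \sum_(i < n | (i < k)%N) K i * M.
  rewrite (bigD1 j)//=; congr (_ + _); apply: eq_bigl => i.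
  by rewrite ltnS [RHS]ltn_neqAle -val_eqE/= andbC.
have step s : (0, p q k) + s *: e j = (0, p q k + s *: delta_mx ord0 j) :> R * 'rV[R]_n.
  by congr pair => /=; rewrite ?scaler0 ?addr0.
have pS : p q k.+1 = p q k + q ord0 j *: delta_mx ord0 j.
  apply/rowP => i; rewrite !mxE /= ltnS.
  have [ij|ij] := eqVneq i j; first by rewrite ij /= leqnn ltnn add0r mulr1.
  by rewrite mulr0 addr0 leq_eqVlt (_ : (val i == k) = false)//; exact/negbTE.
have box s : `|s| <= M -> C ((0, p q k) + s *: e j).
  move=> sM; rewrite step; split => /=; first by rewrite lexx.
  move=> i; rewrite !mxE/=.
  have [ij|ij] := eqVneq i j; first by rewrite ij /= ltnn add0r mulr1.
  by rewrite mulr0 addr0; case: ifP => // _; rewrite normr0.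
have D : `|G (0, p q k.+1) - G (0, p q k)| <= K j * M.
  have [K0 KjP] := KP j.
  have qjM := qM j; have := qjM; rewrite ler_norml => qjM'.
  have E0 : (0, p q k) = (0, p q k) + 0 *: e j by rewrite scale0r addr0.
  have ES : (0, p q k.+1) = (0, p q k) + q ord0 j *: e j by rewrite step pS.
  rewrite ES {2}E0.
  (* The mean value bound needs ordered endpoints, so the edge is traversed according to the sign of
     the coordinate. *)
  have [q0|q0] := leP 0 (q ord0 j).
    apply: (le_trans (derive_line_lipschitz G (0, p q k) (e j) (K j) 0 (q ord0 j) q0 _ _)) => //.
      by move=> s s0; apply: KjP; apply: box; rewrite ler_norml; lra.
    by rewrite ler_wpM2l//; lra.
  rewrite distrC.
  apply: (le_trans (derive_line_lipschitz G (0, p q k) (e j) (K j) (q ord0 j) 0 (ltW q0) _ _)) => //.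
    by move=> s s0; apply: KjP; apply: box; rewrite ler_norml; lra.
  by rewrite ler_wpM2l//; lra.
rewrite -(subrK (G (0, p q k)) (G (0, p q k.+1))).
by apply: (le_trans (ler_normD _ _)); lra.
Qed.

(** [K] bounds the time derivative on the compact strip; the uniform bound is the one at time 0 plus
    the drift [K * T]. *)
Lemma C1_on_strip_time_lipschitz (T M : R) H : 0 <= M -> 0 <= T -> C1_on_strip T H ->
  exists K, exists B, [/\ 0 <= K,
    (forall q s t, in_box M q -> 0 <= s -> s <= t -> t <= T ->
       `|H t q - H s q| <= K * (t - s)) &
    (forall q t, in_box M q -> 0 <= t <= T -> `|H t q| <= B)].
Proof.
move=> M0 T0 [G [dG [cG GH]]].
have [B BP] := box_bounded G M M0 dG cG.
pose e : R * 'rV[R]_n := (1, 0).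
have [K K0 KP] := continuous_compact_norm_le _ _ (compact_strip_box T M) (cG e).
have step q s : (0, q) + s *: e = (s, q).
  by congr pair => /=; rewrite ?scaler0 ?addr0// add0r [_ *: _]mulr1.
have lip q s t : in_box M q -> 0 <= s -> s <= t -> t <= T ->
    `|H t q - H s q| <= K * (t - s).
  move=> qM s0 st tT; rewrite -!GH; [|lra|lra].
  rewrite -(step q t) -(step q s); apply: derive_line_lipschitz => // r rst.
  by rewrite step; apply: KP; split => //=; lra.
exists K, (K * T + B); split=> // q t qM tT.
rewrite -(subrK (H 0 q) (H t q)); apply: (le_trans (ler_normD _ _)).
apply: lerD; last by rewrite -GH ?lexx//; exact: BP.
apply: (le_trans (lip _ _ _ _ _ _ _)) => //; [lra|lra|].
by rewrite ler_wpM2l//; lra.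
Qed.

Lemma C1_on_strip_integrable (T a b : R) H q : 0 <= a -> b <= T -> C1_on_strip T H ->
  lebesgue_measure.-integrable `[a, b] (EFin \o (fun t => H t q)).
Proof.
move=> a0 bT [G [dG [_ GH]]].
pose F (t : R) : R := G ((0, q) + t *: (1, 0)).
have iF : lebesgue_measure.-integrable `[a, b] (EFin \o F).
  apply: continuous_compact_integrable; first exact: segment_compact.
  apply: derivable_within_continuous => t _.
  by case: (is_derive_line G (0, q) (1, 0) t (dG _ _)).
apply: eq_integrable iF => // t; rewrite inE/= in_itv/= => tab; congr EFin.
rewrite -GH; last lra.
by congr (G (_, _)) => /=; rewrite ?scaler0 ?addr0// add0r [_ *: _]mulr1.
Qed.

End C1Strip.

(** * Time integrals of the Hamiltonian *)

Section IntH.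
Context {R : realType} {n : nat}.
Context (T : R) (H : R -> 'rV[R]_n -> R).
Context (C1H : C1_on_strip T H).
Implicit Types (q : 'rV[R]_n).

Lemma intH_cat (a s t : R) q : 0 <= a -> a <= s -> s <= t -> t <= T ->
  intH H a t q = intH H a s q + intH H s t q.
Proof.
move=> a0 as_ st tT; rewrite /intH.
have := @Rintegral_itvB R (fun t => H t q) (BLeft a) (BRight t) s.
rewrite !bnd_simp => /(_ _ as_ st) h.
(* Removing [[a, s]] from [[a, t]] leaves []s, t]]; the endpoint [s] has measure zero. *)
rewrite -(@Rintegral_itv_obnd_cbnd _ s (BRight t)).
  by rewrite -h ?subrKC//; exact: C1_on_strip_integrable C1H.
have s0 : 0 <= s by lra.
apply: integrableS (C1_on_strip_integrable T s t H q s0 tT C1H) => //.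
by apply: subset_itvr; rewrite bnd_simp.
Qed.

Lemma intH_id (a : R) q : intH H a a q = 0.
Proof. by rewrite /intH set_itv1 Rintegral_set1. Qed.

Lemma intH_bounds (s t m m' : R) q : 0 <= s -> s <= t -> t <= T ->
  (forall r, s <= r <= t -> m <= H r q <= m') ->
  m * (t - s) <= intH H s t q <= m' * (t - s).
Proof.
move=> s0 st tT mH.
have int_cst c : \int[lebesgue_measure]_(_ in `[s, t]) c = c * (t - s).
  rewrite Rintegral_cst//= lebesgue_measure_itv/= lte_fin.
  by case: ltgtP st => // ->; rewrite subrr.
have icst c : lebesgue_measure.-integrable `[s, t] (EFin \o (fun=> c : R)).
  apply: continuous_compact_integrable; first exact: segment_compact.
  by apply: continuous_subspaceT => ?; exact: cvg_cst.
have iH := C1_on_strip_integrable T s t H q s0 tT C1H.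
by rewrite -(int_cst m) -(int_cst m'); apply/andP; split; apply: le_Rintegral => //=;
  move=> r; rewrite in_itv/= => /mH /andP[].
Qed.

End IntH.

(** * Convexity of the Hopf formula up to a quadratic in time *)

Section HopfFormula.
Context {R : realType} {n : nat}.
Context (T M K B : R) (H : R -> 'rV[R]_n -> R).
Context (C1H : C1_on_strip T H).
Context (K0 : 0 <= K).
Context (lipH : forall q s t, in_box M q -> 0 <= s -> s <= t -> t <= T ->
  `|H t q - H s q| <= K * (t - s)).
Context (bndH : forall q t, in_box M q -> 0 <= t <= T -> `|H t q| <= B).
Implicit Types (A : 'rV[R]_n -> \bar R) (q x : 'rV[R]_n).

(** For [t1 <= t2], cancelling common integrals leaves [(1 - l)] times the integral over [[t, t2]]
    minus [l] times that over [[t1, t]]. Freezing [H] at time [t], the terms in [H t q] cancel and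
    the Lipschitz errors add up to the stated one. *)
Lemma intH_semiconcave (a t1 t2 l : R) q : in_box M q -> 0 <= a ->
  a <= t1 <= T -> a <= t2 <= T -> 0 <= l <= 1 ->
  l * intH H a t1 q + (1 - l) * intH H a t2 q
    <= intH H a (l * t1 + (1 - l) * t2) q + K * (l * (1 - l) * (t1 - t2) ^+ 2).
Proof.
move=> qM a0; wlog t12 : t1 t2 l / t1 <= t2.
  move=> wl t1T t2T l01; have [t12|/ltW t21] := leP t1 t2; first exact: wl.
  have := wl t2 t1 (1 - l) t21 t2T t1T.
  rewrite subKr (addrC (_ * t2)) (addrC (_ * intH H a t2 q)) (mulrC (1 - l) l).
  by rewrite -(sqrrN (t2 - t1)) opprB; apply; lra.
move=> t1T t2T l01; set t := l * t1 + _.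
have t1t : t - t1 = (1 - l) * (t2 - t1) by rewrite /t; ring.
have tt2 : t2 - t = l * (t2 - t1) by rewrite /t; ring.
have d0 : 0 <= t2 - t1 by lra.
have [l0 l1] : 0 <= l /\ 0 <= 1 - l by lra.
have t1t0 : 0 <= t - t1 by rewrite t1t mulr_ge0.
have tt20 : 0 <= t2 - t by rewrite tt2 mulr_ge0.
clearbody t.
rewrite (intH_cat T H C1H a t1 t); [|lra|lra|lra|lra].
rewrite (intH_cat T H C1H a t1 t2); [|lra|lra|lra|lra].
rewrite (intH_cat T H C1H t1 t t2); [|lra|lra|lra|lra].
have /andP[J1 _] : (H t q - K * (t - t1)) * (t - t1) <= intH H t1 t q
    <= (H t q + K * (t - t1)) * (t - t1).
  apply: (intH_bounds T H C1H); [lra|lra|lra|move=> r rt].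
  have := lipH q r t qM; rewrite ler_norml => /(_ _ _ _)/andP[]; [lra|lra|lra|].
  have := ler_wpM2l K0 (_ : t - r <= t - t1) => /(_ ltac:(lra)); lra.
have /andP[_ J2] : (H t q - K * (t2 - t)) * (t2 - t) <= intH H t t2 q
    <= (H t q + K * (t2 - t)) * (t2 - t).
  apply: (intH_bounds T H C1H); [lra|lra|lra|move=> r rt].
  have := lipH q t r qM; rewrite ler_norml => /(_ _ _ _)/andP[]; [lra|lra|lra|].
  have := ler_wpM2l K0 (_ : r - t <= t2 - t) => /(_ ltac:(lra)); lra.
have := ler_wpM2l l0 J1; have := ler_wpM2l l1 J2.
rewrite t1t tt2 -(sqrrN (t1 - t2)) opprB expr2; lra.
Qed.

Lemma intH_bounded (a t : R) q : in_box M q -> 0 <= a -> a <= t -> t <= T ->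
  `|intH H a t q| <= B * T.
Proof.
move=> qM a0 at_ tT.
have B0 : 0 <= B by apply: le_trans (bndH q a qM _); [exact: normr_ge0|lra].
have : - B * (t - a) <= intH H a t q <= B * (t - a).
  apply: (intH_bounds T H C1H) => // r rt.
  by rewrite -ler_norml; apply: bndH => //; lra.
have : B * (t - a) <= B * T by rewrite ler_wpM2l//; lra.
by rewrite ler_norml; lra.
Qed.

Lemma hopf_fin_num A (a t : R) x : proper_in_box M A -> 0 <= a ->
  a <= t -> t <= T -> fconj (fun q => A q + (intH H a t q)%:E)%E x \is a fin_num.
Proof.
move=> MA a0 at_ tT; apply: (fconj_fin_num M _ _ (B * T)) => // q qM.
exact: intH_bounded.
Qed.

Lemma hopf_jointly_convex A (a : R) : proper_in_box M A -> 0 <= a ->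
  jointly_convex a T (fun t x =>
    fine (fconj (fun q => A q + (intH H a t q)%:E)%E x) + K * t ^+ 2).
Proof.
move=> MA a0 t1 t2 x1 x2 l t1T t2T l01; have [[c Ac] _ Abox] := MA.
set t := l * t1 + _.
have tT : a <= t <= T by rewrite /t; nra.
have u1 : fconj (fun q => A q + (intH H a t1 q)%:E)%E x1 \is a fin_num.
  by apply: hopf_fin_num => //; lra.
have u2 : fconj (fun q => A q + (intH H a t2 q)%:E)%E x2 \is a fin_num.
  by apply: hopf_fin_num => //; lra.
have /fineK E : fconj (fun q => A q + (intH H a t q)%:E)%E (l *: x1 + (1 - l) *: x2)
    \is a fin_num by apply: hopf_fin_num => //; lra.
have Ay q : A q != -oo%E by move: (Ac q); case: (A q).
have := fconj_semiconvex l (K * (l * (1 - l) * (t1 - t2) ^+ 2)) A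
  (intH H a t) (intH H a t1) (intH H a t2) x1 x2 l01 Ay.
move=> /(_ _ u1 u2)/=; rewrite -E lee_fin => h.
have {}h := h (fun q Aq => intH_semiconcave a t1 t2 l q (Abox q Aq) a0 t1T t2T l01).
(* The convexity defect of [K * t ^+ 2] is exactly the error from [intH_semiconcave]. *)
have tE : t ^+ 2 = l * t1 ^+ 2 + (1 - l) * t2 ^+ 2 - l * (1 - l) * (t1 - t2) ^+ 2.
  by rewrite /t; ring.
rewrite tE; lra.
Qed.

End HopfFormula.

(** The Lipschitz bound gives the box; a subgradient of [sigma] at 0 is a point where the conjugate
    is finite. *)
Lemma lipschitz_convex_fconj_proper (R : realType) (n : nat) (sigma : 'rV[R]_n -> R) :
  convex_fun sigma -> lipschitz_fun sigma ->
  exists2 M, 0 <= M & proper_in_box M (fconj (fun p => (sigma p)%:E)).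
Proof.
move=> cs [L lips]; exists `|L| => //; apply: proper_in_box_fconj => //.
  exists (sigma 0) => p; rewrite lee_fin.
  have := lips p 0; rewrite subr0 ler_norml.
  have : L * enorm p <= `|L| * l1norm p.
    apply: le_trans (ler_wpM2r (sqrtr_ge0 _) (ler_norm L)) _.
    by rewrite ler_wpM2l// enorm_le_l1norm.
  lra.
have [a sa] := convex_fun_affine_minorant sigma cs.
exists a; apply: le_lt_trans (ltry (- sigma 0)); apply: fconj_le => q.
by rewrite -EFinB lee_fin; have := sa q; lra.
Qed.

(** * Comparison of the two pieces *)

Section Patching.
Context {R : realType} {n : nat}.
Context (T : R) (H : R -> 'rV[R]_n -> R) (sigma : 'rV[R]_n -> R).
Context (C1H : C1_on_strip T H).

Lemma u_first_le_u_second (tp t : R) x : 0 <= tp -> tp <= t -> t <= T ->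
  (u_first sigma H t x <= u_second sigma H tp t x)%E.
Proof.
move=> tp0 tpt tT; apply: le_fconj => q.
rewrite (intH_cat T H C1H 0 tp t)// EFinD addeA leeD2r//.
exact: fconjK_le.
Qed.

(** At [tp] the integral vanishes, so the second piece is the biconjugate of omega. *)
Lemma u_second_le_u_first (tp : R) x :
  (u_second sigma H tp tp x <= u_first sigma H tp x)%E.
Proof.
rewrite /u_second.
under [X in fconj X]eq_fun do rewrite intH_id adde0.
exact: fconjK_le.
Qed.

End Patching.

(** * Semiconvexity of the patched function *)

Theorem theorem3p6 (R : realType) (n : nat) (T tp : R)
    (H : R -> 'rV[R]_n -> R) (sigma : 'rV[R]_n -> R) :
  0 < T ->
  C1_on_strip T H ->
  convex_fun sigma -> lipschitz_fun sigma ->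
  0 < tp < T ->
  condA2 0 tp H -> condA2 tp T H ->
  (forall t x, 0 < t < T -> u_fun sigma H tp t x \is a fin_num) /\
  semiconvex_lin T (fun t x => fine (u_fun sigma H tp t x)).
Proof.
move=> T0 C1H cs ls tpT _ _.
have [M M0 Ms] := lipschitz_convex_fconj_proper R n sigma cs ls.
have [K [B [K0 lipH bndH]]] := C1_on_strip_time_lipschitz T M H M0 (ltW T0) C1H.
have Mo : proper_in_box M (fconj (u_first sigma H tp)).
  apply: proper_in_box_fconj => //.
    apply: (fconj_linear_growth M _ _ (B * T)) => // q qM.
    by apply: (intH_bounded T M B) => //; lra.
  (* Since omega^* is at most sigma^* plus a finite integral, a point of the domain of sigma^* lies
     in that of omega^*. *)
  have [_ [q sq] _] := Ms; exists q.
  apply: le_lt_trans (fconjK_le _ q) _.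
  by rewrite lte_add_pinfty// ltry.
have fin1 t x : 0 <= t <= T -> u_first sigma H t x \is a fin_num.
  by move=> tT; apply: (hopf_fin_num T M B) => //; lra.
have fin2 t x : tp <= t <= T -> u_second sigma H tp t x \is a fin_num.
  by move=> tT; apply: (hopf_fin_num T M B) => //; lra.
split.
  move=> t x tT; rewrite /u_fun; case: ifPn => [_|]; first by apply: fin1; lra.
  by rewrite -ltNge => ?; apply: fin2; lra.
have conv : jointly_convex 0 T (fun t x => fine (u_fun sigma H tp t x) + K * t ^+ 2).
  rewrite (_ : (fun t x => _) = fun t x => if t <= tp
      then fine (u_first sigma H t x) + K * t ^+ 2
      else fine (u_second sigma H tp t x) + K * t ^+ 2); last first.
    by apply/funext => t; apply/funext => x; rewrite /u_fun; case: ifP.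
  apply: jointly_convex_glue; first lra.
  - exact: (hopf_jointly_convex T M K B).
  - by apply: (hopf_jointly_convex T M K B) => //; lra.
  - move=> t x tT; rewrite lerD2r fine_le ?fin1 ?fin2//; [lra|].
    by apply: (u_first_le_u_second T) => //; lra.
  - move=> x; rewrite lerD2r fine_le ?fin1 ?fin2//; [lra|lra|].
    exact: u_second_le_u_first.
(* Half of this is [K], the coefficient of the added quadratic, plus one to keep the constant
   positive when [K = 0]; the surplus terms, including those in [x], are nonnegative. *)
exists (2 * (K + 1)); split; first by lra.
move=> t1 t2 x1 x2 l t1T t2T l01.
have := conv t1 t2 x1 x2 l ltac:(lra) ltac:(lra) l01.
set u := fine (u_fun _ _ _ (_ + _) _); set u1 := fine (u_fun _ _ _ t1 _).
set u2 := fine (u_fun _ _ _ t2 _).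
have ll : 0 <= l * (1 - l) by nra.
have := mulr_ge0 ll (sqr_ge0 (t1 - t2)).
have := mulr_ge0 ll (sqnorm_ge0 (x1 - x2)).
move: (sqnorm _) => N N0; have := mulr_ge0 K0 N0.
clearbody u u1 u2; clear -N0; lra.
Qed.
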